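(* A (nonzero) Laurent polynomial $L\in\mathbb{C}[z_1^{\pm1},\dots,z_D^{\pm1}]$ is nice if and only if for each subset $\sigma\subseteq\{1,\dots,D\}$ the set $\operatorname{NP}_\sigma(L)$ contains elements of longitude $\ell(L)$.
   Context: For $x\in\mathbb{R}^D$ (in particular for multi-indices $\alpha\in\mathbb{Z}^D$) the longitude is $|x|=\sum_{a=1}^D|x_a|$. For a nonzero Laurent polynomial $L=\sum_{\alpha\in\mathcal A}L_\alpha z^\alpha$ with support $\mathcal A$ (finite set of $\alpha$ with $L_\alpha\ne0$), its longitude is $\ell(L)=\max_{\alpha\in\mathcal A}|\alpha|$ and its Newton polytope $\operatorname{NP}(L)\subset\mathbb{R}^D$ is the convex hull of $\mathcal A$. $L$ is called nice if $\ell(LM)=\ell(L)+\ell(M)$ for every (nonzero) Laurent polynomial $M$. For $\sigma\subseteq\{1,\dots,D\}$ the closed orthant is $\overline{(\mathbb{R}^D)_\sigma}=\{x\in\mathbb{R}^D: x_i\le0\text{ for }i\in\sigma,\ x_i\ge0\text{ for }i\notin\sigma\}$, and $\operatorname{NP}_\sigma(L)=\operatorname{NP}(L)\cap\overline{(\mathbb{R}^D)_\sigma}$. *)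

(* Defs.v *)
From HB Require Import structures.
From mathcomp Require Import all_boot all_order all_algebra finmap.
From mathcomp Require Import monalg.
From mathcomp Require Import classical_sets reals convex.
From mathcomp.real_closed Require Import complex.

Set Implicit Arguments.
Unset Strict Implicit.
Unset Printing Implicit Defensive.

Import Order.TTheory GRing.Theory Num.Theory.

Local Open Scope fset_scope.
Local Open Scope ring_scope.

(* The Laurent polynomial ring K[z_1^±1, ..., z_D^±1]: finitely supported
   functions from exponent vectors in Z^D to K, with the convolution product.
   The ring structure of [malg] is only available over a [monomType], whose
   monoid law has no nontrivial units, so Z^D is excluded and the product is
   defined here for the alias [laurent]. *)
Definition laurent (K : comNzRingType) (D : nat) : Type :=
  {malg K['rV[int]_D]}.

Section LaurentRing.
Variables (K : comNzRingType) (D : nat).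
Implicit Types (L M P : {malg K['rV[int]_D]}) (a b : 'rV[int]_D) (c d : K).

Definition laurent_one : {malg K['rV[int]_D]} := << 1 *g (0 : 'rV[int]_D) >>.

Definition laurent_mul L M : {malg K['rV[int]_D]} :=
  \sum_(a <- msupp L) \sum_(b <- msupp M)
     << L@_a * M@_b *g (a + b)%R >>.

Lemma laurent_mulw (A B : {fset 'rV[int]_D}) L M :
  msupp L `<=` A -> msupp M `<=` B ->
  laurent_mul L M =
  \sum_(a <- A) \sum_(b <- B) << L@_a * M@_b *g (a + b)%R >>.
Proof.
move=> le_A le_B; rewrite /laurent_mul (big_fset_incl _ le_A) /=.
  apply/eq_bigr => a _; apply/big_fset_incl => // b _ /mcoeff_outdom ->.
  by rewrite mulr0 monalgU0.
move=> a _ /mcoeff_outdom La.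
by rewrite big1 // => b _; rewrite La mul0r monalgU0.
Qed.

Lemma laurent_mulC : commutative laurent_mul.
Proof.
move=> L M; rewrite /laurent_mul exchange_big /=.
by apply/eq_bigr => a _; apply/eq_bigr => b _; rewrite mulrC addrC.
Qed.

Lemma laurent_mulDl : left_distributive laurent_mul +%R.
Proof.
move=> L M P; rewrite (laurent_mulw (msuppD_le L M) (fsubset_refl (msupp P))).
rewrite (laurent_mulw (fsubsetUl _ (msupp M)) (fsubset_refl (msupp P))).
rewrite (laurent_mulw (fsubsetUr (msupp L) _) (fsubset_refl (msupp P))).
rewrite -big_split /=; apply/eq_bigr => a _.
rewrite -big_split /=; apply/eq_bigr => b _.
by rewrite mcoeffD mulrDl monalgUD.
Qed.

Lemma laurent_mulDr : right_distributive laurent_mul +%R.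
Proof. by move=> L M P; rewrite !(laurent_mulC L) laurent_mulDl. Qed.

Lemma laurent_mul0l : left_zero 0 laurent_mul.
Proof. by move=> L; rewrite /laurent_mul msupp0 big_seq_fset0. Qed.

Lemma laurent_mul0r : right_zero 0 laurent_mul.
Proof. by move=> L; rewrite laurent_mulC laurent_mul0l. Qed.

Lemma laurent_mulU c a M :
  laurent_mul << c *g a >> M =
  \sum_(b <- msupp M) << c * M@_b *g (a + b)%R >>.
Proof.
rewrite (laurent_mulw msuppU_le (fsubset_refl _)) big_seq_fset1.
by apply/eq_bigr => b _; rewrite mcoeffUU.
Qed.

Lemma laurent_mulUU c d a b :
  laurent_mul << c *g a >> << d *g b >> = << c * d *g (a + b)%R >>.
Proof. by rewrite (laurent_mulw msuppU_le msuppU_le) !big_seq_fset1 !mcoeffUU. Qed.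

Lemma laurent_mul1l : left_id laurent_one laurent_mul.
Proof.
move=> L; rewrite laurent_mulU [RHS]monalgE.
by apply/eq_bigr => a _; rewrite mul1r add0r.
Qed.

Lemma laurent_mul_suml I (r : seq I) (F : I -> {malg K['rV[int]_D]}) M :
  laurent_mul (\sum_(i <- r) F i) M = \sum_(i <- r) laurent_mul (F i) M.
Proof.
exact: (big_morph (laurent_mul^~ M) (fun _ _ => laurent_mulDl _ _ _)
  (laurent_mul0l M)).
Qed.

Lemma laurent_mul_sumr I (r : seq I) (F : I -> {malg K['rV[int]_D]}) L :
  laurent_mul L (\sum_(i <- r) F i) = \sum_(i <- r) laurent_mul L (F i).
Proof.
exact: (big_morph (laurent_mul L) (fun _ _ => laurent_mulDr _ _ _)
  (laurent_mul0r L)).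
Qed.

Lemma laurent_mulA : associative laurent_mul.
Proof.
move=> L M P; rewrite (monalgE L) !laurent_mul_suml; apply/eq_bigr => a _.
rewrite (monalgE M) laurent_mul_suml !laurent_mul_sumr laurent_mul_suml.
apply/eq_bigr => b _.
rewrite (monalgE P) !laurent_mul_sumr; apply/eq_bigr => e _.
by rewrite !laurent_mulUU mulrA addrA.
Qed.

Lemma laurent_one_neq0 : laurent_one != 0.
Proof. by rewrite monalgU_eq0 oner_eq0. Qed.

HB.instance Definition _ := GRing.Zmodule.on (laurent K D).
HB.instance Definition _ := GRing.Zmodule_isComNzRing.Build (laurent K D)
  laurent_mulA laurent_mulC laurent_mul1l laurent_mulDl laurent_one_neq0.

End LaurentRing.

Definition longitude (R : numDomainType) (D : nat) (x : 'rV[R]_D) : R :=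
  \sum_(a < D) `|x 0 a|.

(* Longitudes are nonnegative, so the base value 0 does not affect the maximum
   over the (nonempty) support of a nonzero L. *)
Definition laurent_longitude (K : comNzRingType) (D : nat) (L : laurent K D)
    : int :=
  \big[Num.max/0]_(a <- msupp L) longitude a.

Definition nice (K : comNzRingType) (D : nat) (L : laurent K D) : Prop :=
  forall M : laurent K D, M != 0 ->
    laurent_longitude (L * M) = laurent_longitude L + laurent_longitude M.

Local Open Scope classical_set_scope.

Definition convex_hull (R : numDomainType) (V : lmodType R) (A : set V)
    : set V :=
  smallest (@convex_set R V) A.

Definition newton_polytope (R : realType) (K : comNzRingType) (D : nat)
    (L : laurent K D) : set 'rV[R]_D :=
  convex_hull [set map_mx intr a | a in [set a : 'rV[int]_D | a \in msupp L]].

Definition closed_orthant (R : realType) (D : nat) (sigma : {set 'I_D})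
    : set 'rV[R]_D :=
  [set x : 'rV[R]_D | forall i, if i \in sigma then x 0 i <= 0 else 0 <= x 0 i].

Definition newton_polytope_orthant (R : realType) (K : comNzRingType) (D : nat)
    (sigma : {set 'I_D}) (L : laurent K D) : set 'rV[R]_D :=
  newton_polytope L `&` closed_orthant sigma.

(* Main.v *)
Require Import Defs.
From mathcomp Require Import all_boot all_order all_algebra finmap.
From mathcomp Require Import monalg.
From mathcomp Require Import classical_sets reals convex.
From mathcomp.real_closed Require Import complex.
From mathcomp Require Import interval_inference.
From mathcomp Require Import zify ring.

Import Order.TTheory GRing.Theory Num.Theory.

Local Open Scope ring_scope.

(** The longitude is the maximum over sigma of the linear forms
    [signed_sum sigma], and equals [signed_sum sigma] exactly on the closed
    orthant of sigma.  Hence the condition on the Newton polytope says that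
    every such form reaches the value l(L) on the support of L.  If so, niceness
    follows because the maximum of a linear form over supports is additive under
    products.  If the maximum m of some form on the support of L is smaller than
    l(L), multiplying L by a monomial z^b with b deep inside the orthant of sigma
    moves the whole support into that orthant, and the product has longitude
    m + |b| < l(L) + |b|. *)

Lemma seq_argmax (T : eqType) (f : T -> int) (s : seq T) : s != [::] ->
  exists2 x, x \in s & {in s, forall y, f y <= f x}.
Proof.
elim: s => // x [_ _|z s IH _].
  by exists x => [|y]; rewrite ?mem_head// inE => /eqP ->.
have [y ys ymax] := IH isT.
have [le_xy|lt_yx] := leP (f x) (f y).
  exists y => [|t]; first by rewrite inE ys orbT.
  by rewrite inE => /orP[/eqP ->//|/ymax].
exists x => [|t]; first exact: mem_head.
by rewrite inE => /orP[/eqP ->//|/ymax/le_trans]; apply; apply: ltW.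
Qed.

(** * Signed coordinate sums and the orthants where they equal the longitude *)

Section SignedSum.
Variables (D : nat) (sigma : {set 'I_D}).

(** The pairing with a sign vector, a vertex of the unit ball of the dual norm. The ring [R] is an
    argument so that the same form applies to integer exponents and to real points. *)
Definition signed_sum {R : numDomainType} (x : 'rV[R]_D) : R :=
  \sum_(i < D) (if i \in sigma then - x 0 i else x 0 i).

Lemma signed_sumD (R : numDomainType) :
  {morph @signed_sum R : x y / x + y}.
Proof.
move=> x y; rewrite /signed_sum -big_split; apply: eq_bigr => i _ /=.
by rewrite mxE; case: ifP => // _; rewrite opprD.
Qed.

Lemma signed_sumZ (R : numDomainType) (k : R) (x : 'rV[R]_D) :
  signed_sum (k *: x) = k * signed_sum x.
Proof.
rewrite /signed_sum mulr_sumr; apply: eq_bigr => i _.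
by rewrite mxE; case: ifP; rewrite ?mulrN.
Qed.

Lemma signed_sum_intr (R : numDomainType) (a : 'rV[int]_D) :
  signed_sum (map_mx intr a : 'rV[R]_D) = (signed_sum a)%:~R.
Proof.
rewrite /signed_sum rmorph_sum; apply: eq_bigr => i _ /=.
by rewrite mxE; case: ifP => // _; rewrite rmorphN.
Qed.

Lemma signed_sum_le_longitude (R : realDomainType) (x : 'rV[R]_D) :
  signed_sum x <= longitude x.
Proof.
apply: ler_sum => i _; case: ifP => _; last exact: ler_norm.
by rewrite -normrN ler_norm.
Qed.

(** The two sums compare term by term, so if they agree, nonnegative differences add up to zero and
    each of them vanishes; this fixes the sign of every coordinate. *)
Lemma longitude_eq_signed_sum (R : realDomainType) (x : 'rV[R]_D) :
  (forall i, if i \in sigma then x 0 i <= 0 else 0 <= x 0 i) <->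
  longitude x = signed_sum x.
Proof.
split=> [x_sigma|eq_x i].
  apply: eq_bigr => i _; have := x_sigma i.
  by case: ifP => _ x_i; [rewrite ler0_norm | rewrite ger0_norm].
have diff_ge0 j : true ->
    0 <= `|x 0 j| - (if j \in sigma then - x 0 j else x 0 j).
  by move=> _; rewrite subr_ge0; case: ifP => _; [rewrite -normrN|]; apply: ler_norm.
have diff_sum0 :
    \sum_(j < D) (`|x 0 j| - (if j \in sigma then - x 0 j else x 0 j)) = 0.
  by rewrite sumrB -/(longitude x) eq_x subrr.
move/psumr_eq0P: diff_ge0 => /(_ diff_sum0 i isT) /eqP.
by rewrite subr_eq0; case: ifP => _ /eqP norm_xi; [rewrite -oppr_ge0|];
  rewrite -norm_xi normr_ge0.
Qed.

End SignedSum.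

Arguments signed_sum {D} sigma {R} x.

(** * The longitude as a norm *)

Section Longitude.
Variables (R : realDomainType) (D : nat).
Implicit Types x y : 'rV[R]_D.

Lemma longitude_ge0 x : 0 <= longitude x.
Proof. exact: sumr_ge0. Qed.

Lemma longitudeD x y : longitude (x + y) <= longitude x + longitude y.
Proof.
by rewrite -big_split; apply: ler_sum => i _; rewrite mxE ler_normD.
Qed.

Lemma norm_le_longitude x i : `|x 0 i| <= longitude x.
Proof. by rewrite /longitude (bigD1 i)//= lerDl sumr_ge0. Qed.

(** Every point lies in some closed orthant, so the bound of [signed_sum] by [longitude] is attained
    for a suitable [sigma]. *)
Lemma longitude_signed_sum_neg x :
  longitude x = signed_sum [set i | x 0 i < 0] x.
Proof.
by apply/longitude_eq_signed_sum => i; rewrite inE; case: ltP => // /ltW.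
Qed.

End Longitude.

Lemma longitude_intr (R : realDomainType) (D : nat) (a : 'rV[int]_D) :
  longitude (map_mx intr a : 'rV[R]_D) = (longitude a)%:~R.
Proof.
by rewrite /longitude rmorph_sum; apply: eq_bigr => i _ /=; rewrite mxE intr_norm.
Qed.

(* Among the pairs maximizing w, take one whose sum has the largest Euclidean
   norm.  If a' + b' = a + b with d = b' - b, then a + b' = (a + b) + d and
   a' + b = (a + b) - d, and by the parallelogram law one of them is longer
   than a + b unless d = 0. *)
Lemma unique_maximal_sum (D : nat) (w : 'rV[int]_D -> int)
    (A B : seq 'rV[int]_D) :
  {morph w : x y / x + y} -> A != [::] -> B != [::] ->
  exists a b, [/\ a \in A, b \in B, {in A, forall a', w a' <= w a},
    {in B, forall b', w b' <= w b} &
    forall a' b', a' \in A -> b' \in B -> a' + b' = a + b -> a' = a /\ b' = b].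
Proof.
move=> wD /(@seq_argmax _ w)[a0 a0A a0max] /(@seq_argmax _ w)[b0 b0B b0max].
pose sqn (x : 'rV[int]_D) := \sum_(i < D) x 0 i ^+ 2.
pose A1 := [seq a <- A | w a == w a0]; pose B1 := [seq b <- B | w b == w b0].
pose s := [seq (a, b) | a <- A1, b <- B1].
have s_neq0 : s != [::].
  have: (a0, b0) \in s by apply: allpairs_f; rewrite mem_filter eqxx.
  by case: s.
have [p /allpairsP[[a b] /= [aA1 bB1 ->]] pmax] :=
  seq_argmax _ (fun p => sqn (p.1 + p.2)) _ s_neq0.
move: (aA1) (bB1); rewrite !mem_filter => /andP[/eqP wa aA] /andP[/eqP wb bB].
exists a, b; split=> // [a'|b'|a' b' a'A b'B sumE].
- by rewrite wa; apply: a0max.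
- by rewrite wb; apply: b0max.
(* Neither summand can exceed its maximum and the totals agree, so [a'] and [b'] are maximizers too,
   and the mixed pairs belong to [s]. *)
have wsum : w a' + w b' = w a0 + w b0 by rewrite -wD sumE wD wa wb.
have wa' : w a' = w a0.
  by apply/eqP; rewrite eq_le a0max// -(lerD2r (w b')) wsum lerD2l b0max.
have wb' : w b' = w b0 by move: wsum; rewrite wa' => /addrI.
have a'A1 : a' \in A1 by rewrite mem_filter wa' eqxx.
have b'B1 : b' \in B1 by rewrite mem_filter wb' eqxx.
have /= le1 := pmax (a, b') (allpairs_f _ aA1 b'B1).
have /= le2 := pmax (a', b) (allpairs_f _ a'A1 bB1).
have a'E : a' = a + b - b' by rewrite -sumE addrK.
have parallelogram :
    sqn (a + b') + sqn (a' + b) = sqn (a + b) *+ 2 + sqn (b' - b) *+ 2.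
  rewrite a'E /sqn -!sumrMnl -!big_split /=; apply: eq_bigr => i _.
  by rewrite !mxE; ring.
have sqn_ge0 : 0 <= sqn (b' - b) by apply: sumr_ge0 => i _; apply: sqr_ge0.
have sqn_eq0 : sqn (b' - b) = 0.
  move: le1 le2 parallelogram sqn_ge0.
  move: (sqn (a + b')) (sqn (a' + b)) (sqn (a + b)) (sqn (b' - b)).
  by clear; move=> x y z t; lia.
have b'b : b' = b.
  apply/eqP; rewrite -subr_eq0; apply/eqP/rowP => i; rewrite [RHS]mxE.
  have sqr_ge0' j : true -> 0 <= (b' - b) 0 j ^+ 2 by rewrite sqr_ge0.
  by apply/eqP; rewrite -sqrf_eq0; apply/eqP/(psumr_eq0P sqr_ge0' sqn_eq0).
by split=> //; rewrite a'E b'b addrK.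
Qed.

(** * Supports and longitudes of products, and the criterion for niceness *)

Section LaurentSupport.
Variables (K : idomainType) (D : nat).
Implicit Types (L M : laurent K D) (a b c : 'rV[int]_D).

Lemma laurent_neq0_msupp L : L != 0 -> (msupp L : seq 'rV[int]_D) != [::].
Proof.
by apply: contra_neq => L0; rewrite (monalgE L) L0 big_nil.
Qed.

Lemma mcoeff_laurent_mul L M c :
  mcoeff c (L * M) = \sum_(a <- msupp L) \sum_(b <- msupp M)
    (mcoeff a L * mcoeff b M) *+ (a + b == c).
Proof.
rewrite [L * M]/(laurent_mul L M) raddf_sum; apply: eq_bigr => a _ /=.
by rewrite raddf_sum; apply: eq_bigr => b _ /=; rewrite mcoeffU.
Qed.

Lemma msupp_laurent_mul L M c : c \in msupp (L * M) ->
  exists a b, [/\ a \in msupp L, b \in msupp M & c = a + b].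
Proof.
rewrite -mcoeff_neq0 mcoeff_laurent_mul => c_neq0.
have [/hasP[a aL /hasP[b bM /eqP <-]]|no_ab] := boolP (has (fun a =>
    has (fun b => a + b == c) (msupp M)) (msupp L)).
  by exists a, b.
case/eqP: c_neq0; rewrite big_seq big1// => a aL; rewrite big_seq big1// => b bM.
case: eqP => // abc; case/hasP: no_ab; exists a => //.
by apply/hasP; exists b => //; apply/eqP.
Qed.

Lemma le_laurent_longitude L a : a \in msupp L ->
  longitude a <= laurent_longitude L.
Proof. by move=> aL; apply: (le_bigmax_seq 0 _ xpredT). Qed.

(** The bound [0 <= m] accounts for the base value of the maximum, so the lemma also applies to a
    product not yet known to be nonzero. *)
Lemma laurent_longitude_le L (m : int) :
  0 <= m -> {in msupp L, forall a, longitude a <= m} ->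
  laurent_longitude L <= m.
Proof. by move=> m0 Lm; rewrite /laurent_longitude big_seq; apply: bigmax_le. Qed.

Lemma laurent_longitude_attained L : L != 0 ->
  exists2 a, a \in msupp L & laurent_longitude L = longitude a.
Proof.
move=> /laurent_neq0_msupp/(@seq_argmax _ (@longitude _ D))[a aL amax].
exists a => //; apply/eqP; rewrite eq_le le_laurent_longitude// andbT.
by apply: laurent_longitude_le => //; apply: longitude_ge0.
Qed.

Lemma laurent_longitude_ge0 L : 0 <= laurent_longitude L.
Proof.
rewrite /laurent_longitude; elim/big_ind: _ => // [x y x0 _|a _].
  by rewrite le_max x0.
exact: longitude_ge0.
Qed.

Lemma laurent_longitude_mul_le L M :
  laurent_longitude (L * M) <= laurent_longitude L + laurent_longitude M.
Proof.
apply: laurent_longitude_le => [|c /msupp_laurent_mul[a [b [aL bM ->]]]].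
  by rewrite addr_ge0// laurent_longitude_ge0.
by rewrite (le_trans (longitudeD _ _ _ _))// lerD// le_laurent_longitude.
Qed.

(** Some sum of maximizers of the form decomposes in only one way over the two supports. Its
    coefficient in the product is then a single product of nonzero coefficients, so it cannot
    cancel. *)
Lemma signed_sum_le_longitude_mul sigma L M a b :
  a \in msupp L -> b \in msupp M ->
  signed_sum sigma a + signed_sum sigma b <= laurent_longitude (L * M).
Proof.
move=> aL bM.
have L0 : L != 0 by apply: contraTneq aL => ->; rewrite msupp0 in_fset0.
have M0 : M != 0 by apply: contraTneq bM => ->; rewrite msupp0 in_fset0.
have [a1 [b1 [a1L b1M amax bmax uniq_ab]]] :=
  unique_maximal_sum _ _ _ _ (signed_sumD _ sigma int)
    (laurent_neq0_msupp _ L0) (laurent_neq0_msupp _ M0).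
have ab_supp : a1 + b1 \in msupp (L * M).
  (* The term at [(a1, b1)] is split off. Supports have no duplicates, so any other contributing
     term would contradict uniqueness. *)
  rewrite -mcoeff_neq0 mcoeff_laurent_mul (big_rem a1)//= (big_rem b1)//= eqxx.
  rewrite big_seq big1 ?addr0 => [|b' b'M]; last first.
    case: eqP => // abE.
    have [_ b'E] := uniq_ab _ _ a1L (mem_rem b'M) abE.
    by move: b'M; rewrite b'E mem_rem_uniqF ?fset_uniq.
  rewrite big_seq big1 ?addr0 => [|a' a'L]; last first.
    rewrite big_seq big1// => b' b'M; case: eqP => // abE.
    have [a'E _] := uniq_ab _ _ (mem_rem a'L) b'M abE.
    by move: a'L; rewrite a'E mem_rem_uniqF ?fset_uniq.
  by rewrite mulr1n mulf_neq0// mcoeff_neq0.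
apply: le_trans (le_laurent_longitude _ _ ab_supp).
apply: le_trans (signed_sum_le_longitude _ sigma _ _).
by rewrite signed_sumD lerD ?amax ?bmax.
Qed.

Lemma nice_signed_sum L : L != 0 ->
  nice L <-> forall sigma : {set 'I_D},
    exists2 a, a \in msupp L & signed_sum sigma a = laurent_longitude L.
Proof.
move=> L0; split=> [niceL sigma|L_sigma M M0]; last first.
  apply/eqP; rewrite eq_le laurent_longitude_mul_le/=.
  (* The signs of a longest exponent [b] of [M] choose [sigma]; the hypothesis for this [sigma]
     makes both longitudes values of one linear form. *)
  have [b bM ->] := laurent_longitude_attained _ M0.
  rewrite longitude_signed_sum_neg.
  have [a aL <-] := L_sigma [set i | b 0 i < 0].
  exact: signed_sum_le_longitude_mul.
have [a aL amax] := seq_argmax _ (signed_sum sigma) _ (laurent_neq0_msupp _ L0).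
exists a => //; apply/eqP; rewrite eq_le.
rewrite (le_trans (signed_sum_le_longitude _ _ _ _)) ?le_laurent_longitude//=.
pose l := laurent_longitude L.
(* No coordinate of an exponent of [L] exceeds [l] in absolute value, so adding [b] moves each
   exponent into the closed orthant of [sigma]. *)
pose b : 'rV[int]_D := \row_i (if i \in sigma then - l else l).
pose M : laurent K D := << 1 *g b >>.
have MsuppE : msupp M = [fset b]%fset by rewrite msuppU oner_eq0.
have M0 : M != 0 by rewrite monalgU_eq0 oner_eq0.
have longitudeM : laurent_longitude M = longitude b.
  have [c cM ->] := laurent_longitude_attained _ M0.
  by move: cM; rewrite MsuppE inE => /eqP ->.
have shifted c : c \in msupp L ->
    longitude (c + b) = signed_sum sigma c + signed_sum sigma b.
  move=> cL; rewrite -signed_sumD; apply/longitude_eq_signed_sum => i.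
  have := le_trans (norm_le_longitude _ _ c i) (le_laurent_longitude _ _ cL).
  rewrite -/l ler_norml !mxE; case: (i \in sigma) => /andP[lo hi].
    by rewrite subr_le0.
  by rewrite -lerBlDr sub0r.
have longitude_b : longitude b = signed_sum sigma b.
  apply/longitude_eq_signed_sum => i; rewrite mxE.
  by case: (i \in sigma); rewrite ?oppr_le0 laurent_longitude_ge0.
(* With [longitude b] added to both sides, niceness turns the goal into an upper bound for the
   longitude of [L * M], whose exponents are all of the form [c + b]. *)
rewrite -(lerD2r (longitude b)) -{1}longitudeM -niceL// longitude_b -shifted//.
apply: laurent_longitude_le => [|e /msupp_laurent_mul[c [b' [cL]]]].
  exact: longitude_ge0.
by rewrite MsuppE inE => /eqP -> ->; rewrite !shifted// lerD2r amax.
Qed.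

End LaurentSupport.

(** * Passage from the Newton polytope to the support *)

(** A closed half-space is convex, so it contains the hull of any set that it contains. *)
Lemma convex_hull_signed_sum_le (R : realType) (D : nat) (sigma : {set 'I_D})
    (A : set 'rV[R]_D) (m : R) (x : 'rV[R]_D) :
  (forall y, A y -> signed_sum sigma y <= m) ->
  convex_hull A x -> signed_sum sigma x <= m.
Proof.
move=> Am hx.
suff /(_ x hx) : (convex_hull A `<=` [set y | signed_sum sigma y <= m])%classic.
  by [].
apply: smallest_sub => // y z t /set_mem /= ym /set_mem /= zm; apply/mem_set => /=.
rewrite /conv /= signed_sumD !signed_sumZ.
have t0 : 0 <= t%:num by exact: ge0.
have t1 : t%:num <= 1 by exact: le1.
have -> : m = t%:num * m + (1 - t%:num) * m by ring.
by rewrite lerD// ler_wpM2l// subr_ge0.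
Qed.

(** A linear form is bounded on the polytope by its maximum over the support, so a real point of
    longitude [laurent_longitude L] in the orthant can be traded for an exponent of [L]. *)
Lemma newton_polytope_orthant_longitude (R : realType) (K : idomainType)
    (D : nat) (L : laurent K D) (sigma : {set 'I_D}) : L != 0 ->
  (exists x : 'rV[R]_D, newton_polytope_orthant sigma L x /\
     longitude x = (laurent_longitude L)%:~R) <->
  exists2 a, a \in msupp L & signed_sum sigma a = laurent_longitude L.
Proof.
move=> L0; split=> [[x [[x_hull /longitude_eq_signed_sum x_sigma] x_l]]|].
  have [a aL amax] :=
    seq_argmax _ (signed_sum sigma) _ (laurent_neq0_msupp _ _ _ L0).
  exists a => //; apply/eqP; rewrite eq_le.
  rewrite (le_trans (signed_sum_le_longitude _ _ _ _)) ?le_laurent_longitude//=.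
  rewrite -(ler_int R) -x_l x_sigma.
  apply: convex_hull_signed_sum_le x_hull => _ [c /= cL <-].
  by rewrite signed_sum_intr ler_int amax.
move=> [a aL al].
(* The longitude of [a] is squeezed between the value of the form and the maximum; this equality is
   also what places [a] in the orthant. *)
have a_l : longitude a = laurent_longitude L.
  apply/eqP; rewrite eq_le le_laurent_longitude//=.
  by rewrite -al signed_sum_le_longitude.
exists (map_mx intr a); split; last by rewrite longitude_intr a_l.
split; first by apply: sub_gen_smallest; exists a.
by apply/longitude_eq_signed_sum; rewrite longitude_intr signed_sum_intr a_l al.
Qed.

Theorem proposition3p14 (R : realType) (D : nat) (L : laurent R[i] D)
    (hL : L != 0) :
  nice L <->
  forall sigma : {set 'I_D},
    exists x : 'rV[R]_D,
      newton_polytope_orthant sigma L x /\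
      longitude x = (laurent_longitude L)%:~R.
Proof.
apply: iff_trans (nice_signed_sum _ _ _ hL) _.
by split=> H sigma; apply/newton_polytope_orthant_longitude/H.
Qed.
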